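(* Let $M=(a,b)\times N$ carry the metrics $g=dr^2+G(r)$ and $g_0=dr^2+\mathring{h}^2(r)\hat G$ described in the context, and let $m=\mathring{h}^{2}(\mathring{H}-H)$ be the radial mass of $g$ relative to $g_0$. Then on $M$ $$\partial_r m=\mathring{h}^{2}(R_{rr}-\mathring{R}_{rr})+\frac{1}{n-1}\frac{m^2}{\mathring{h}^2}+\mathring{h}^{2}|s|^2,$$ where $s$ is the trace-free part of the $g$-Weingarten map of $N(r)=\{r\}\times N$, and $R_{rr}$ and $\mathring{R}_{rr}=-(n-1)\frac{\mathring{h}''}{\mathring{h}}$ are the Ricci curvatures in the $(\partial_r,\partial_r)$ direction of $g$ and $g_0$ respectively.
   Context: Let $n\geq 2$, let $N$ be a compact $(n-1)$-dimensional smooth manifold (with or without boundary), let $(a,b)$ be an open interval of $\mathbb R$, and $M=(a,b)\times N$, with $r$ the coordinate on $(a,b)$. All objects are assumed $C^\infty$. Let $g=dr^2+G(r)$ be a Riemannian metric on $M$, where $G(r)$ is a family of Riemannian metrics on $N$. Let $g_0=dr^2+\mathring{h}^2(r)\hat{G}$, where $\mathring{h}$ is a positive function on $(a,b)$ and $\hat{G}$ is a fixed Riemannian metric on $N$. The $g$-Weingarten map (shape operator) of $N(r)$ with respect to $\partial_r$ is $S=\frac12 G^{-1}\partial_rG$, i.e. $S_A^B=\frac12G^{BC}\partial_rG_{AC}$ in local coordinates on $N$; $H=\operatorname{Tr}S$ is the mean curvature of $N(r)$ relative to $g$, and $\mathring H=(n-1)\mathring h'/\mathring h$ is the mean curvature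 of $N(r)$ relative to $g_0$. The trace-free part of $S$ is $s=S-\frac{1}{n-1}H\,I$, and $|s|$ is its norm with respect to $G(r)$ (so $|s|^2=\operatorname{Tr}(s\circ s)$). *)

(* Defs.v *)
From HB Require Import structures.
From mathcomp Require Import all_boot all_order all_algebra.
From mathcomp Require Import all_classical all_reals all_analysis.
Import Order.TTheory GRing.Theory Num.Theory.
Import numFieldNormedType.Exports.

Set Implicit Arguments.
Unset Strict Implicit.
Unset Printing Implicit Defensive.

Local Open Scope ring_scope.
Local Open Scope classical_set_scope.

(** * Smooth functions on subsets of R^k *)

Section Calculus.
Context {R : realType} {k : nat}.
Implicit Types (O A : set 'rV[R]_k) (f : 'rV[R]_k -> R).

Definition basis_vec (i : 'I_k) : 'rV[R]_k := delta_mx 0 i.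

Fixpoint Ck_on (m : nat) O f : Prop :=
  {in O, continuous f} /\
  if m is m'.+1 then
    forall i : 'I_k, (forall x, O x -> derivable f x (basis_vec i)) /\
                     Ck_on m' O ('D_(basis_vec i) f)
  else True.

(* On a set that need not be open (here: relatively open in a half-space),
   smooth means: locally the restriction of a smooth function on an open set. *)
Definition smooth_on A f : Prop :=
  forall x, A x -> exists (O : set 'rV[R]_k) (F : 'rV[R]_k -> R),
    [/\ open O, O x, forall m, Ck_on m O F & forall y, O y -> A y -> F y = f y].

(* i-th partial derivative of a function of which only the values on A matter;
   on the boundary of a half-space it is the one-sided derivative. *)
Definition pderiv A (i : 'I_k) f (x : 'rV[R]_k) : R :=
  lim ((fun t : R => t^-1 * (f (x + t *: basis_vec i) - f x))
       @ within [set t | A (x + t *: basis_vec i)] 0^').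

(* The closed half-space of R^k where the last coordinate is nonnegative. *)
Definition half_space : set 'rV[R]_k :=
  [set x | forall i : 'I_k, i.+1 = k -> 0 <= x 0 i].

End Calculus.

(** * Smooth manifolds with (possibly empty) boundary *)

(* [chart_param c] is the inverse of the coordinate map [chart_coord c]; the
   values of [chart_coord c] off [chart_dom c] and of [chart_param c] off the
   image of the chart are irrelevant. *)
Record atlas (R : realType) (k : nat) (X : Type) := Atlas {
  chart : Type;
  chart_dom : chart -> set X;
  chart_coord : chart -> X -> 'rV[R]_k;
  chart_param : chart -> 'rV[R]_k -> X }.

Section Manifold.
Context {R : realType} {k : nat}.

Definition chart_img {X : Type} (A : atlas R k X) (c : chart A) :
    set 'rV[R]_k :=
  chart_coord c @` chart_dom c.

Definition overlap {X : Type} (A : atlas R k X) (c c' : chart A) :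
    set 'rV[R]_k :=
  chart_coord c @` (chart_dom c `&` chart_dom c').

Definition transition {X : Type} (A : atlas R k X) (c c' : chart A)
    (x : 'rV[R]_k) : 'rV[R]_k :=
  chart_coord c' (chart_param c x).

Record is_smooth_manifold {X : topologicalType} (A : atlas R k X) : Prop := {
  manifold_hausdorff : hausdorff_space X;
  manifold_second_countable : @second_countable X;
  manifold_cover : forall p : X, exists c : chart A, chart_dom c p;
  chart_dom_open : forall c : chart A, open (chart_dom c);
  chart_img_open : forall c : chart A,
    exists2 O : set 'rV[R]_k, open O & chart_img c = O `&` half_space;
  chart_coordK : forall (c : chart A) p,
    chart_dom c p -> chart_param c (chart_coord c p) = p;
  chart_coord_continuous : forall c : chart A,
    {within chart_dom c, continuous (chart_coord c)};
  chart_param_continuous : forall c : chart A,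
    {within chart_img c, continuous (chart_param c)};
  transition_smooth : forall (c c' : chart A) (j : 'I_k),
    smooth_on (overlap c c') (fun x => transition c c' x 0 j) }.

(** * Riemannian metrics and their curvature *)

(* [g c p] is the matrix (g_ij) at p of a covariant 2-tensor in the coordinates
   of the chart c; it is meaningful for p in [chart_dom c]. *)
Definition tensor2 {X : Type} (A : atlas R k X) := chart A -> X -> 'M[R]_k.

(* Entry (i, j): the i-th partial derivative of the j-th new coordinate. *)
Definition transition_jacobian {X : Type} (A : atlas R k X) (c c' : chart A)
    (p : X) : 'M[R]_k :=
  \matrix_(i, j)
    pderiv (overlap c c') i (fun x => transition c c' x 0 j) (chart_coord c p).

Record is_riemannian {X : Type} (A : atlas R k X) (g : tensor2 A) : Prop := {
  riem_sym : forall (c : chart A) p, chart_dom c p -> (g c p)^T = g c p;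
  riem_pos : forall (c : chart A) p (v : 'rV[R]_k), chart_dom c p -> v != 0 ->
    0 < (v *m g c p *m v^T) 0 0;
  riem_smooth : forall (c : chart A) (i j : 'I_k),
    smooth_on (chart_img c) (fun x => g c (chart_param c x) i j);
  riem_change : forall (c c' : chart A) p, chart_dom c p -> chart_dom c' p ->
    g c p =
    transition_jacobian c c' p *m g c' p *m (transition_jacobian c c' p)^T }.

Section Curvature.
Context {X : Type} {A : atlas R k X}.
Variables (g : tensor2 A) (c : chart A).
Implicit Types (x : 'rV[R]_k) (i j l q : 'I_k).

Definition gloc x i j : R := g c (chart_param c x) i j.

(* Gamma^l_ij of the Levi-Civita connection *)
Definition christoffel l i j x : R :=
  2^-1 * \sum_q invmx (g c (chart_param c x)) l q *
    (pderiv (chart_img c) i (fun y => gloc y j q) x +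
     pderiv (chart_img c) j (fun y => gloc y i q) x -
     pderiv (chart_img c) q (fun y => gloc y i j) x).

(* R_ijk^l, where R(d_i, d_j) d_k = sum_l R_ijk^l d_l and
   R(U, V) W = D_U D_V W - D_V D_U W - D_[U,V] W *)
Definition riemann_curv i j q l x : R :=
  pderiv (chart_img c) i (christoffel l j q) x -
  pderiv (chart_img c) j (christoffel l i q) x +
  \sum_s (christoffel s j q x * christoffel l i s x -
          christoffel s i q x * christoffel l j s x).

(* Ric(V, W) is the trace of U |-> R(U, V) W. *)
Definition ricci j q (p : X) : R :=
  \sum_i riemann_curv i j q i (chart_coord c p).

End Curvature.
End Manifold.

(** * The product (a,b) x N and metrics dr^2 + G(r) *)

Section Product.
Context {R : realType} {k : nat} {N : Type}.
Variables (a b : \bar R) (A : atlas R k N).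

Definition oint : set R := [set r | (a < r%:E)%E /\ (r%:E < b)%E].

(* Coordinates (r, x^1, ..., x^k). The last one is nonnegative, as for N. *)
Definition prod_atlas : atlas R (1 + k) (R * N) := {|
  chart := chart A;
  chart_dom := fun c => [set z | oint z.1 /\ chart_dom c z.2];
  chart_coord := fun c z => row_mx z.1%:M (chart_coord c z.2);
  chart_param := fun c x => (lsubmx x 0 0, chart_param c (rsubmx x)) |}.

Definition dr2_plus (G : R -> tensor2 A) : tensor2 prod_atlas :=
  fun (c : chart A) (z : R * N) => block_mx 1%:M 0 0 (G z.1 c z.2).

Definition ricci_rr (G : R -> tensor2 A) (c : chart A) (r : R) (p : N) : R :=
  @ricci R (1 + k) (R * N) prod_atlas (dr2_plus G) c
    (lshift k ord0) (lshift k ord0) (r, p).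

End Product.

Arguments dr2_plus {R k N} a b {A} G.
Arguments ricci_rr {R k N} a b {A} G c r p.

(** * Extrinsic geometry of the slices N(r) = {r} x N *)

Section Slices.
Context {R : realType} {k : nat} {N : Type} {A : atlas R k N}.
Variables (G : R -> tensor2 A) (c : chart A) (r : R) (p : N).

Definition dr_tensor : 'M[R]_k :=
  \matrix_(i, j) (fun t : R => G t c p i j)^`() r.

(* The entry (i, j) is S_i^j = 1/2 G^jl d_r G_il; thus S acts on row vectors
   on the right. *)
Definition weingarten : 'M[R]_k :=
  \matrix_(i, j) (2^-1 * \sum_l invmx (G r c p) j l * dr_tensor i l).

Definition mean_curvature : R := \tr weingarten.

Definition weingarten_tracefree : 'M[R]_k :=
  weingarten - (mean_curvature / k%:R)%:M.

End Slices.

(* |T|^2 = G^ij G_lq T_i^l T_j^q for an endomorphism field T_i^l *)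
Definition endo_normsq {R : realType} {k : nat} (G T : 'M[R]_k) : R :=
  \sum_i \sum_j \sum_l \sum_q invmx G i j * G l q * T i l * T j q.

Definition warped {R : realType} {k : nat} {N : Type} {A : atlas R k N}
    (h : R -> R) (Ghat : tensor2 A) : R -> tensor2 A :=
  fun r c p => h r ^+ 2 *: Ghat c p.

(* h^2 times the difference of the mean curvatures of the slices, relative to
   dr^2 + h^2 Ghat and to dr^2 + G(r) *)
Definition radial_mass {R : realType} {k : nat} {N : Type} {A : atlas R k N}
    (h : R -> R) (Ghat : tensor2 A) (G : R -> tensor2 A)
    (c : chart A) (r : R) (p : N) : R :=
  h r ^+ 2 * (mean_curvature (warped h Ghat) c r p - mean_curvature G c r p).

Definition smooth_oint {R : realType} (a b : \bar R) (h : R -> R) : Prop :=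
  forall (m : nat) (r : R), oint a b r -> derivable (h^`(m)) r 1.

(* Main.v *)
Require Import Defs.
From mathcomp Require Import all_boot all_order all_algebra.
From mathcomp Require Import all_classical all_reals all_analysis.
From mathcomp Require Import ring lra.
Import Order.TTheory GRing.Theory Num.Theory.
Import numFieldNormedType.Exports.

Local Open Scope ring_scope.
Local Open Scope classical_set_scope.

(** Both metrics have the form dr^2 + G(r), so the curves r |-> (r, p) are unit
speed geodesics and the slices obey a Riccati equation. In coordinates: the
components g_rr = 1 and g_rA = 0 are constant, hence Gamma^l_rr = 0, and the only
nonzero Christoffel symbols with a lower index r are Gamma^B_Ar = Gamma^B_rA = S_A^B
([christoffel_00], [christoffel_radial_coord]). Tracing the curvature tensor
gives ([ricci_rr_riccati])
[[
  R_rr = - d_r H - Tr (S o S).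
]]
For the background h^2 Ghat one has S = (h'/h) I, which yields its mean curvature
k h'/h, with k = n - 1, and its Ricci curvature - k h''/h.

For g, the decomposition Tr (S o S) = |s|^2 + H^2 / k turns the Riccati equation into
d_r H = - R_rr - |s|^2 - H^2 / k; here |s|^2 = Tr (s o s) because S is self-adjoint
with respect to G ([normsq_weingarten_tracefree]). Differentiating
m = h^2 (H0 - H), with h' / h = H0 / k, the terms H0^2, H0 H and H^2 assemble to
the square m^2 / (k h^2).

Two analytic points need care. Partial derivatives are limits along the set of
parameters that stay in the chart image, so the derivative of a constant is 0 only
because these parameters accumulate at 0; this holds at boundary points too, as
[pimg_ray] shows. Also d_r H must exist, which comes from the smoothness of g, read
along the lines r |-> (r, p) ([radially_C2]). *)

(** * Derivatives of determinants, inverses and constants *)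

Section Derivatives.
Context {R : realType}.

Lemma open_oint (a b : \bar R) : open (oint a b).
Proof.
rewrite (_ : oint a b = [set r : R | (a < r%:E)%E] `&` [set r | (r%:E < b)%E]) //.
by apply: openI; [exact: open_ereal_gt | exact: open_ereal_lt].
Qed.

Lemma near_oint (a b : \bar R) (r : R) : oint a b r -> \forall t \near r, oint a b t.
Proof. by move=> rab; apply: open_nbhs_nbhs; split => //; exact: open_oint. Qed.

Lemma derivable_bigsum (I : Type) (s : seq I) (P : pred I) (f : I -> R -> R) (r : R) :
  (forall i, derivable (f i) r 1) ->
  derivable (fun t => \sum_(i <- s | P i) f i t) r 1.
Proof.
move=> df; elim: s => [|i s IH].
  under eq_fun do rewrite big_nil; exact: derivable_cst.
under eq_fun do rewrite big_cons; case: (P i) => //.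
exact: derivableD.
Qed.

Lemma derivable_bigprod (I : Type) (s : seq I) (P : pred I) (f : I -> R -> R) (r : R) :
  (forall i, derivable (f i) r 1) ->
  derivable (fun t => \prod_(i <- s | P i) f i t) r 1.
Proof.
move=> df; elim: s => [|i s IH].
  under eq_fun do rewrite big_nil; exact: derivable_cst.
under eq_fun do rewrite big_cons; case: (P i) => //.
exact: derivableM.
Qed.

Lemma derivable_det n (M : R -> 'M[R]_n) (r : R) :
  (forall i j, derivable (fun t => M t i j) r 1) ->
  derivable (fun t => \det (M t)) r 1.
Proof.
move=> dM; apply: derivable_bigsum => s.
apply: derivableM; first exact: derivable_cst.
exact: derivable_bigprod.
Qed.

(** Cramer's rule makes the entries of the inverse rational in those of [M]. *)
Lemma derivable_invmx n (M : R -> 'M[R]_n) (r : R) :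
  (\forall t \near r, M t \in unitmx) ->
  (forall i j, derivable (fun t => M t i j) r 1) ->
  forall i j, derivable (fun t => invmx (M t) i j) r 1.
Proof.
move=> uM dM i j.
apply: (@near_eq_derivable _ _ _ (fun t => (\det (M t))^-1 * \adj (M t) i j)).
  by near=> t; rewrite /invmx ifT ?mxE//; near: t.
have ur := nbhs_singleton uM.
apply: derivableM.
  apply: derivableV; last exact: derivable_det.
  by move: ur; rewrite unitmxE unitfE.
rewrite (_ : (fun t => _) = (fun t => (-1) ^+ (j + i) *
    \det (row' j (col' i (M t))))); last first.
  by apply/funext => t; rewrite mxE /cofactor.
apply: derivableM; first exact: derivable_cst.
apply: derivable_det => u v.
under eq_fun do rewrite !mxE; exact: dM.
Unshelve. all: by end_near. Qed.

End Derivatives.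

Section Pderiv.
Context {R : realType} {k : nat}.
Implicit Types (A : set 'rV[R]_k) (f : 'rV[R]_k -> R).

(** The first hypothesis makes the filter in [pderiv] proper; along an improper
    filter every value would be a limit. *)
Lemma pderiv_const A i f x (C : R) :
  (forall e : R, 0 < e -> exists2 t : R, 0 < t < e & A (x + t *: basis_vec i)) ->
  A x -> (forall y, A y -> f y = C) -> pderiv A i f x = 0.
Proof.
move=> Ax0 Ax fC; rewrite /pderiv.
set F := within _ _.
have FP : ProperFilter F.
  apply: Build_ProperFilter => F0; move: (F0).
  rewrite /F /within /= /dnbhs /= => /nbhs_ballP[e /= e0 eb].
  have [t /andP[t0 te] At] := Ax0 _ e0.
  apply: (eb t) => //.
    by rewrite /ball /= sub0r normrN gtr0_norm.
  by rewrite /= gt_eqF.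
apply: cvg_lim => //.
apply: cvg_near_cst; rewrite /F near_withinE.
by near=> t => At; rewrite !fC// subrr mulr0.
Unshelve. all: by end_near. Qed.

End Pderiv.

(** * Coordinates on the slab (a, b) x N *)

Section Slab.
Context {R : realType} {k : nat} {N : topologicalType} {A : atlas R k N}.
Hypothesis hA : is_smooth_manifold A.
Variables (a b : \bar R) (c : chart A).
Local Notation PA := (prod_atlas a b A).
Local Notation pimg := (@chart_img R (1 + k) (R * N) PA c).
Local Notation pcoord := (@chart_coord R (1 + k) (R * N) PA c).
Local Notation e0 := (lshift k (@ord0 0)).

Lemma pcoordD (t s : R) (p : N) :
  pcoord (t, p) + s *: basis_vec e0 = pcoord (t + s, p).
Proof.
apply/rowP => j; rewrite /= !mxE; case: split_ordP => u ->.
  by rewrite [u]ord1 !mxE !eqxx /= !mulr1n mulr1.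
by rewrite eq_rlshift andbF mulr0 addr0.
Qed.

Lemma pimgE (y : 'rV[R]_(1 + k)) :
  pimg y <-> oint a b (lsubmx y 0 0) /\ chart_img c (rsubmx y).
Proof.
split.
  move=> [[t p] [/= rt dp]] <-; rewrite row_mxKl row_mxKr mxE eqxx mulr1n.
  by split => //; exists p.
move=> [ry [p dp py]]; exists (lsubmx y 0 0, p); first by [].
rewrite /= py -[RHS]hsubmxK; congr (row_mx _ _).
by rewrite [RHS]mx11_scalar.
Qed.

Lemma pimg_coord (t : R) (p : N) :
  chart_dom c p -> pimg (pcoord (t, p)) <-> oint a b t.
Proof.
move=> dp; rewrite pimgE /= row_mxKl row_mxKr mxE eqxx mulr1n.
by split => [[]//|?]; split => //; exists p.
Qed.

(** The half-space is a lower bound on the last coordinate, so increasing any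
    coordinate keeps a point in it; the other conditions on [pimg] are open. *)
Lemma pimg_ray (y : 'rV[R]_(1 + k)) (i : 'I_(1 + k)) : pimg y ->
  forall e : R, 0 < e -> exists2 t : R, 0 < t < e & pimg (y + t *: basis_vec i).
Proof.
move=> /pimgE[ry yc] e ep.
have [U oU imgU] := chart_img_open hA c.
have [Uy Hy] : (U `&` half_space) (rsubmx y) by rewrite -imgU.
have cvl : forall t : R, lsubmx (y + t *: basis_vec i) 0 0 =
    lsubmx y 0 0 + t * (i == e0)%:R.
  by move=> t; rewrite !mxE eqxx eq_sym.
have cvr : forall t : R, rsubmx (y + t *: basis_vec i) =
    rsubmx y + t *: rsubmx (basis_vec i).
  by move=> t; rewrite linearD linearZ.
have near_oint0 : \forall t \near (0 : R), oint a b (lsubmx y 0 0 + t * (i == e0)%:R).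
  have : (fun t : R => lsubmx y 0 0 + t * (i == e0)%:R) @ (0 : R) -->
      lsubmx y 0 0 + 0 * (i == e0)%:R.
    by apply: cvgD; [exact: cvg_cst | apply: cvgM; [exact: cvg_id | exact: cvg_cst]].
  by rewrite mul0r addr0; apply; exact: near_oint.
have near_U0 : \forall t \near (0 : R), U (rsubmx y + t *: rsubmx (basis_vec i)).
  have : (fun t : R => rsubmx y + t *: rsubmx (basis_vec i)) @ (0 : R) -->
      rsubmx y + (0 : R) *: rsubmx (basis_vec i).
    by apply: cvgD; [exact: cvg_cst | apply: cvgZ; [exact: cvg_id | exact: cvg_cst]].
  by rewrite scale0r addr0; apply; apply: open_nbhs_nbhs; split.
have /nbhs_ballP[d /= d0 db] : \forall t \near (0 : R),
    oint a b (lsubmx y 0 0 + t * (i == e0)%:R) /\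
    U (rsubmx y + t *: rsubmx (basis_vec i)) by near=> t; split; near: t.
pose t := Num.min d e / 2.
have m0 : 0 < Num.min d e by rewrite lt_min d0 ep.
have t0 : 0 < t by rewrite divr_gt0.
have tm : t < Num.min d e by rewrite /t; lra.
move: (tm); rewrite lt_min => /andP[td te].
exists t; first by rewrite t0.
have [|P1 P2] := db t; first by rewrite /ball /= sub0r normrN gtr0_norm.
apply/pimgE; rewrite cvl cvr imgU; split; first by [].
split; first by [].
move=> j jk; rewrite !mxE; apply: addr_ge0; last first.
  by rewrite mulr_ge0 ?ler0n// ltW.
by have := Hy j jk; rewrite mxE.
Unshelve. all: by end_near. Qed.

Lemma pderiv_const_pimg i f (y : 'rV[R]_(1 + k)) (C : R) :
  pimg y -> (forall z, pimg z -> f z = C) -> pderiv pimg i f y = 0.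
Proof. by move=> py fC; exact: (pderiv_const _ _ _ _ _ (pimg_ray y i py) py fC). Qed.

(** The radial direction has no boundary, so for small parameters the line stays
    in the chart image and the restricted limit is an ordinary derivative. *)
Lemma pderiv_radial f (t : R) (p : N) : oint a b t -> chart_dom c p ->
  pderiv pimg e0 f (pcoord (t, p)) = (fun s => f (pcoord (s, p)))^`() t.
Proof.
move=> rt dp; rewrite /pderiv /derive1.
have near_img : \forall s \near 0^', pimg (pcoord (t, p) + s *: basis_vec e0).
  apply: nbhs_dnbhs; near=> s; rewrite pcoordD; apply/pimg_coord => //.
  near: s.
  have : (fun s : R => t + s) @ (0 : R) --> t.
    rewrite -[X in _ --> X]addr0.
    by apply: cvgD; [exact: cvg_cst | exact: cvg_id].
  by apply; exact: near_oint.
have -> : within [set s | pimg (pcoord (t, p) + s *: basis_vec e0)] 0^' = 0^'.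
  apply/seteqP; split => [B|B FB]; last by apply: filterS FB => s Bs _.
  by rewrite /within /= => WB; apply: filterS2 near_img WB => s /= Ps PB; exact: PB.
congr (lim (_ @ 0^')); apply/funext => s.
by rewrite pcoordD [t + s]addrC.
Unshelve. all: by end_near. Qed.

End Slab.

(** * The Riccati equation *)

Section Riccati.
Context {R : realType} {k : nat} {N : topologicalType} {A : atlas R k N}.
Hypothesis hA : is_smooth_manifold A.
Variables (a b : \bar R) (c : chart A) (G : R -> tensor2 A) (p : N).
Hypothesis dp : chart_dom c p.
Local Notation PA := (prod_atlas a b A).
Local Notation pimg := (@chart_img R (1 + k) (R * N) PA c).
Local Notation pcoord := (@chart_coord R (1 + k) (R * N) PA c).
Local Notation pparam := (@chart_param R (1 + k) (R * N) PA c).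
Local Notation e0 := (lshift k (@ord0 0)).
Local Notation g := (dr2_plus a b G).
Local Notation Gamma := (@christoffel R (1 + k) (R * N) PA g c).

Let pparamK (t : R) : pparam (pcoord (t, p)) = (t, p).
Proof. by rewrite /= row_mxKl row_mxKr mxE eqxx mulr1n (chart_coordK hA). Qed.

(** This holds at every point of the coordinate space, whatever the values of G
   are, because the blocks of [dr2_plus] are constant. *)
Let gloc_radial (y : 'rV[R]_(1 + k)) j :
  gloc g c y e0 j = (j == e0)%:R /\ gloc g c y j e0 = (j == e0)%:R.
Proof.
rewrite /gloc /dr2_plus; case: (split_ordP j) => u ->.
  by rewrite [u]ord1 block_mxEul mxE !eqxx.
by rewrite block_mxEur block_mxEdl !mxE eq_rlshift.
Qed.

Let pderiv_gloc_radial i j (y : 'rV[R]_(1 + k)) : pimg y ->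
  pderiv pimg i (fun z => gloc g c z e0 j) y = 0 /\
  pderiv pimg i (fun z => gloc g c z j e0) y = 0.
Proof.
move=> py; split; apply: (pderiv_const_pimg hA _ _ _ _ _ _ (j == e0)%:R) => // z _.
  by have [] := gloc_radial z j.
by have [] := gloc_radial z j.
Qed.

Lemma christoffel_00 i (y : 'rV[R]_(1 + k)) : pimg y -> Gamma i e0 e0 y = 0.
Proof.
move=> py; rewrite /christoffel big1 ?mulr0// => q _.
have [-> _] := pderiv_gloc_radial e0 q _ py.
have [-> _] := pderiv_gloc_radial q e0 _ py.
by rewrite addr0 subr0 mulr0.
Qed.

(** In Gamma^l_ir the terms that differentiate g_rq or g_ir vanish, which leaves
    1/2 g^lq d_r g_iq. For block diagonal g this is S in the directions of N, and
    0 as soon as i or l is radial. The symbols Gamma^l_ir and Gamma^l_ri are treated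
    together, since both occur in the curvature. *)
Lemma christoffel_radial_coord i l (t : R) : oint a b t -> G t c p \in unitmx ->
  Gamma l i e0 (pcoord (t, p)) =
    block_mx 0 0 0 (weingarten G c t p) i l /\
  Gamma l e0 i (pcoord (t, p)) =
    block_mx 0 0 0 (weingarten G c t p) i l.
Proof.
move=> rt uG; set W := block_mx _ _ _ _ _ _.
have py : pimg (pcoord (t, p)) by apply/pimg_coord.
suff E : 2^-1 * \sum_q invmx (g c (pparam (pcoord (t, p)))) l q *
    pderiv pimg e0 (fun y => gloc g c y i q) (pcoord (t, p)) = W.
  rewrite -E; split; congr (_ * _); apply: eq_bigr => q _; congr (_ * _).
    have [-> _] := pderiv_gloc_radial i q _ py.
    have [_ ->] := pderiv_gloc_radial q i _ py.
    by rewrite add0r subr0.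
  have [-> _] := pderiv_gloc_radial i q _ py.
  have [-> _] := pderiv_gloc_radial q i _ py.
  by rewrite addr0 subr0.
rewrite pparamK /dr2_plus invmx_block_diag ?block_diag_mx_unit ?unitmx1//.
under eq_bigr do rewrite pderiv_radial//.
have gE s q : @gloc R (1 + k) (R * N) PA g c (pcoord (s, p)) i q =
    block_mx (1%:M : 'M[R]_1) 0 0 (G s c p) i q.
  by rewrite /gloc pparamK.
under eq_bigr => q _ do under eq_fun do rewrite gE.
rewrite big_split_ord /= big_ord1 /W.
case: (split_ordP i) => u ->; last first.
  under eq_fun do rewrite block_mxEdl mxE.
  rewrite derive1_cst mulr0 add0r.
  case: (split_ordP l) => v ->.
    rewrite block_mxEdl mxE big1 ?mulr0// => q _.
    by rewrite block_mxEur mxE mul0r.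
  rewrite block_mxEdr mxE; congr (_ * _); apply: eq_bigr => q _.
  rewrite block_mxEdr mxE; congr (_ * _).
  by under eq_fun do rewrite block_mxEdr.
under eq_fun do rewrite block_mxEul.
rewrite derive1_cst mulr0 add0r big1 => [|q _].
  by rewrite mulr0; case: (split_ordP l) => v ->;
    rewrite ?block_mxEul ?block_mxEur mxE.
under [X in derive1 X _]eq_fun do rewrite block_mxEur mxE.
by rewrite derive1_cst mulr0.
Qed.

(** With Gamma^l_rr = 0 the curvature R_irr^i reduces to
    - d_r Gamma^i_ir - Gamma^s_ir Gamma^i_rs; sum over i. *)
Lemma ricci_rr_riccati (r : R) : oint a b r ->
  (forall t, oint a b t -> G t c p \in unitmx) ->
  (forall i, derivable (fun t => weingarten G c t p i i) r 1) ->
  ricci_rr a b G c r p =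
  - 'D_1 (fun t => mean_curvature G c t p) r
  - \tr (weingarten G c r p *m weingarten G c r p).
Proof.
move=> rr uG dW.
set S := weingarten G c.
have py : pimg (pcoord (r, p)) by apply/pimg_coord.
pose B t : 'M[R]_(1 + k) := block_mx (0 : 'M[R]_1) 0 0 (S t p).
have curvE i : riemann_curv g c i e0 e0 i (pcoord (r, p)) =
    - 'D_1 (fun t => B t i i) r - (B r *m B r) i i.
  rewrite /riemann_curv.
  have -> : pderiv pimg i (Gamma i e0 e0) (pcoord (r, p)) = 0.
    apply: (pderiv_const_pimg hA _ _ _ _ _ _ 0) => // z pz.
    exact: christoffel_00.
  rewrite pderiv_radial// derive1E add0r.
  have -> : 'D_1 (fun s => Gamma i i e0 (pcoord (s, p))) r =
      'D_1 (fun t => B t i i) r.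
    apply: near_eq_derive.
    near=> t; have rt : oint a b t by near: t; exact: near_oint.
    by have [-> _] := christoffel_radial_coord i i t rt (uG t rt).
  congr (_ + _); rewrite mxE -sumrN; apply: eq_bigr => s _.
  rewrite christoffel_00// mul0r add0r.
  have [-> _] := christoffel_radial_coord i s r rr (uG r rr).
  by have [_ ->] := christoffel_radial_coord s i r rr (uG r rr).
rewrite /ricci_rr /ricci; under eq_bigr do rewrite curvE.
rewrite big_split /= !sumrN; congr (- _ - _).
  rewrite /mean_curvature /mxtrace.
  rewrite big_split_ord /= big_ord1.
  rewrite (_ : (fun t => B t e0 e0) = cst 0); last first.
    by apply/funext => t; rewrite /B block_mxEul mxE.
  rewrite derive_cst add0r.
  rewrite (_ : (fun t => _) = \sum_i (fun t => S t p i i)); last first.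
    by apply/funext => t; rewrite fct_sumE.
  rewrite derive_sum//; apply: eq_bigr => i _.
  by congr ('D_1 _ r); apply/funext => t; rewrite /B block_mxEdr.
rewrite -[LHS]/(\tr (B r *m B r)) /B mulmx_block.
by rewrite !(mul0mx, mulmx0, addr0, add0r) mxtrace_block mxtrace0 add0r.
Unshelve. all: by end_near. Qed.

End Riccati.

(** * Linear algebra of the Weingarten map *)

Section SliceAlgebra.
Context {R : realType} {k : nat} {N : Type} {A : atlas R k N}.
Variables (c : chart A) (p : N).

Lemma weingartenE (G : R -> tensor2 A) (t : R) :
  weingarten G c t p = 2^-1 *: (dr_tensor G c t p *m (invmx (G t c p))^T).
Proof.
apply/matrixP => i j; rewrite !mxE; congr (_ * _).
by apply: eq_bigr => l _; rewrite !mxE mulrC.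
Qed.

(** Symmetry of [T *m g] says that the endomorphism T is self-adjoint for g, hence
    equal to its adjoint in |T|^2 = Tr (T^* o T). *)
Lemma endo_normsq_selfadjoint (g T : 'M[R]_k) :
  g \in unitmx -> g^T = g -> (T *m g)^T = T *m g ->
  endo_normsq g T = \tr (T *m T).
Proof.
move=> ug gs Ts.
have -> : endo_normsq g T = \tr (invmx g *m (T *m g *m T^T)^T).
  apply: eq_bigr => i _; rewrite [RHS]mxE; apply: eq_bigr => j _.
  rewrite [_^T j i]mxE [(_ *m _ *m _) i j]mxE mulr_sumr.
  under [RHS]eq_bigr => q _ do rewrite mxE mulr_suml mulr_sumr.
  rewrite exchange_big /=; apply: eq_bigr => l _; apply: eq_bigr => q _.
  by rewrite mxE; ring.
rewrite trmx_mul trmxK Ts mxtrace_mulC !mulmxA.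
by rewrite mulmxK.
Qed.

(** S is self-adjoint because S G = 1/2 d_r G is symmetric, and removing the trace
    H / k subtracts H^2 / k from Tr (S o S). *)
Lemma normsq_weingarten_tracefree (G : R -> tensor2 A) (t : R) : (0 < k)%N ->
  G t c p \in unitmx -> (G t c p)^T = G t c p ->
  (dr_tensor G c t p)^T = dr_tensor G c t p ->
  endo_normsq (G t c p) (weingarten_tracefree G c t p) =
  \tr (weingarten G c t p *m weingarten G c t p)
  - mean_curvature G c t p ^+ 2 / k%:R.
Proof.
move=> k0 uG Gs Ds; have k1 : (k%:R : R) != 0 by rewrite pnatr_eq0 -lt0n.
rewrite endo_normsq_selfadjoint//.
  rewrite /weingarten_tracefree; set H := mean_curvature G c t p.
  set S := weingarten G c t p.
  rewrite mulmxBl !mulmxBr !mul_scalar_mx mul_mx_scalar !linearB /= !linearZ /=.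
  rewrite mxtrace_scalar -[\tr S]/H.
  by rewrite -[(H / _) *+ k]mulr_natr /GRing.scale /=; field.
rewrite /weingarten_tracefree mulmxBl mul_scalar_mx linearB linearZ /= Gs.
congr (_ - _).
rewrite weingartenE trmx_inv Gs -scalemxAl mulmxKV//.
by rewrite linearZ /= Ds.
Qed.

Lemma derivable_weingarten (G : R -> tensor2 A) (r : R) :
  (\forall t \near r, G t c p \in unitmx) ->
  (forall i j, derivable (fun t => G t c p i j) r 1) ->
  (forall i j, derivable (fun t => G t c p i j)^`()%classic r 1) ->
  forall i j, derivable (fun t => weingarten G c t p i j) r 1.
Proof.
move=> uG dG ddG i j; under eq_fun do rewrite mxE.
apply: derivableM; first exact: derivable_cst.
apply: derivable_bigsum => l; apply: derivableM.
  exact: derivable_invmx.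
by under eq_fun do rewrite mxE; exact: ddG.
Qed.

Lemma weingarten_warped (h : R -> R) (Ghat : tensor2 A) (t : R) :
  h t != 0 -> derivable h t 1 ->
  Ghat c p \in unitmx -> (Ghat c p)^T = Ghat c p ->
  weingarten (warped h Ghat) c t p = (h^`()%classic t / h t)%:M.
Proof.
move=> h0 dh uG Gs.
have -> : weingarten (warped h Ghat) c t p =
    2^-1 *: ((h t * h^`()%classic t *+ 2 *: Ghat c p) *m
             (invmx (h t ^+ 2 *: Ghat c p))^T).
  rewrite weingartenE; congr (_ *: (_ *m _)); apply/matrixP => i j.
  rewrite !mxE derive1E.
  have := derivableP dh => dh1.
  under eq_fun do rewrite mxE.
  rewrite derive1E.
  apply: derive_val; apply: is_derive_eq.
  by rewrite /GRing.scale /=; ring.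
rewrite invmxZ; last by rewrite unitmxZ// unitfE expf_neq0.
rewrite linearZ /= trmx_inv Gs -scalemxAl -scalemxAr mulmxV// !scalerA.
by rewrite scalemx1; congr (_%:M); field.
Qed.

End SliceAlgebra.

(** * Radial regularity of the metric *)

Section Smoothness.
Context {R : realType} {k : nat} {N : topologicalType} {A : atlas R k N}.
Hypothesis hA : is_smooth_manifold A.
Variables (a b : \bar R) (c : chart A).
Local Notation PA := (prod_atlas a b A).
Local Notation pcoord := (@chart_coord R (1 + k) (R * N) PA c).
Local Notation e0 := (lshift k (@ord0 0)).

Lemma derivable_line (F : 'rV[R]_(1 + k) -> R) (t : R) (p : N) :
  derivable F (pcoord (t, p)) (basis_vec e0) =
    derivable (fun s => F (pcoord (s, p))) t 1 /\
  'D_(basis_vec e0) F (pcoord (t, p)) = 'D_1 (fun s => F (pcoord (s, p))) t.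
Proof.
rewrite /derivable /derive.
suff -> : (fun s : R => s^-1 *: (F (s *: basis_vec e0 + pcoord (t, p)) -
      F (pcoord (t, p)))) =
    (fun s : R => s^-1 *: (F (pcoord (s *: (1 : R) + t, p)) - F (pcoord (t, p)))).
  by [].
apply/funext => s; rewrite [_ *: basis_vec _ + _]addrC pcoordD.
by rewrite /GRing.scale /= mulr1 [t + s]addrC.
Qed.

(** Near (r, p) the entries of g extend to a function F smooth on an open set, and
    the line t |-> (t, p) stays in that set, so the r-derivatives of G are the
    radial partial derivatives of F. *)
Lemma radially_C2 (G : R -> tensor2 A) (p : N) (r : R) (i j : 'I_k) :
  is_riemannian (dr2_plus a b G) -> oint a b r -> chart_dom c p ->
  derivable (fun t => G t c p i j) r 1 /\
  derivable (fun t => G t c p i j)^`()%classic r 1.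
Proof.
move=> hg rr dp.
have pr : @chart_img R (1 + k) (R * N) PA c (pcoord (r, p)) by apply/pimg_coord.
have [U [F [oU Ur CF FG]]] :=
  @riem_smooth _ _ _ _ _ hg c (rshift 1 i) (rshift 1 j) (pcoord (r, p)) pr.
have [_ /(_ e0)[dF [_ /(_ e0)[ddF _]]]] := CF 2%N.
pose V := [set t : R | F (pcoord (t, p)) = G t c p i j /\ U (pcoord (t, p))].
have Vr : nbhs r V.
  have cvg_coord : (fun t : R => pcoord (r, p) + (t - r) *: basis_vec e0) @ r -->
      pcoord (r, p).
    have : (fun t : R => pcoord (r, p) + (t - r) *: basis_vec e0) @ r -->
        pcoord (r, p) + (r - r) *: basis_vec e0.
      apply: cvgD; first exact: cvg_cst.
      apply: cvgZ; last exact: cvg_cst.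
      by apply: cvgB; [exact: cvg_id | exact: cvg_cst].
    by rewrite subrr scale0r addr0.
  have nU : \forall t \near r, U (pcoord (r, p) + (t - r) *: basis_vec e0).
    by apply: cvg_coord; apply: open_nbhs_nbhs.
  apply: filterS2 nU (near_oint _ _ _ rr) => t.
  rewrite pcoordD addrC subrK => Ut rt; split => //.
  rewrite FG//; last exact/pimg_coord.
  rewrite /dr2_plus block_mxEdr /= row_mxKl row_mxKr mxE eqxx mulr1n.
  by rewrite (chart_coordK hA).
have Ut t : V t -> U (pcoord (t, p)) by case.
have dGt t : nbhs t V -> derivable (fun s => G s c p i j) t 1 /\
    (fun s => G s c p i j)^`()%classic t =
      'D_(basis_vec e0) F (pcoord (t, p)).
  move=> Vt; have [dE DE] := derivable_line F t p.
  have FGt : {near t, (fun s => F (pcoord (s, p))) =1 (fun s => G s c p i j)}.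
    by apply: filterS Vt => s [].
  split; last by rewrite DE derive1E; apply/esym; exact: near_eq_derive.
  apply: near_eq_derivable FGt _; rewrite -dE.
  exact/dF/Ut/(nbhs_singleton Vt).
have [d1 _] := dGt _ Vr; split => //.
have [dE _] := derivable_line ('D_(basis_vec e0) F) r p.
apply: (@near_eq_derivable _ _ _ (fun t => 'D_(basis_vec e0) F (pcoord (t, p)))).
  by apply: filterS (nbhs_interior Vr) => t Vt; have [_ ->] := dGt t Vt.
rewrite -dE; exact/ddF/Ut/(nbhs_singleton Vr).
Qed.

End Smoothness.

(** A kernel vector v would violate g(v, v) > 0. *)
Lemma riemannian_unitmx {R : realType} {k : nat} {X : Type} {A : atlas R k X}
    (g : tensor2 A) (c : chart A) (p : X) :
  is_riemannian g -> chart_dom c p -> g c p \in unitmx.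
Proof.
move=> rg dp; rewrite -row_free_unit -kermx_eq0; apply/rowV0P => v /sub_kermxP vg0.
apply/eqP; apply/negPn/negP => v0.
by have := riem_pos rg dp v0; rewrite vg0 mul0mx mxE ltxx.
Qed.
Lemma derivable_is_derive1 {R : realType} (f : R -> R) (r : R) :
  derivable f r 1 -> is_derive r 1 f (f^`()%classic r).
Proof. by move=> df; rewrite derive1E; exact: (derivableP df). Qed.

Lemma smooth_oint_derivable2 {R : realType} (a b : \bar R) (h : R -> R) (r : R) :
  smooth_oint a b h -> oint a b r ->
  derivable h r 1 /\ derivable h^`()%classic r 1.
Proof. by move=> hs rr; split; [exact: (hs 0%N) | exact: (hs 1%N)]. Qed.

(** * The warped background *)

Section WarpedBackground.
Context {R : realType} {k : nat} {N : topologicalType} {A : atlas R k N}.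
Hypothesis hA : is_smooth_manifold A.
Variables (a b : \bar R) (h : R -> R) (Ghat : tensor2 A).
Hypothesis hsmooth : smooth_oint a b h.
Hypothesis hpos : forall r : R, oint a b r -> 0 < h r.
Hypothesis hGhat : is_riemannian Ghat.
Variables (c : chart A) (p : N).
Hypothesis dp : chart_dom c p.

Let weingarten_warped_oint (t : R) : oint a b t ->
  weingarten (warped h Ghat) c t p = (h^`()%classic t / h t)%:M.
Proof.
move=> rt; have [dh _] := smooth_oint_derivable2 _ _ _ _ hsmooth rt.
apply: weingarten_warped => //; first by rewrite gt_eqF// hpos.
  exact: riemannian_unitmx.
exact: (riem_sym hGhat dp).
Qed.

Lemma mean_curvature_warped (t : R) : oint a b t ->
  mean_curvature (warped h Ghat) c t p = k%:R * (h^`()%classic t / h t).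
Proof.
by move=> rt; rewrite /mean_curvature weingarten_warped_oint// mxtrace_scalar mulr_natl.
Qed.

Let is_derive_log (r : R) : oint a b r ->
  is_derive r 1 (fun t => h^`()%classic t / h t)
    (h^`(2)%classic r / h r - (h^`()%classic r / h r) ^+ 2).
Proof.
move=> rr; have [dh ddh] := smooth_oint_derivable2 _ _ _ _ hsmooth rr.
have h0 : h r != 0 by rewrite gt_eqF// hpos.
have D1 := derivable_is_derive1 _ _ dh.
have D2 : is_derive r 1 h^`()%classic (h^`(2)%classic r) :=
  derivable_is_derive1 _ _ ddh.
have DV : is_derive r 1 (fun t => (h t)^-1) (- (h r) ^- 2 *: h^`()%classic r).
  by rewrite derive1E; apply: (DeriveDef (derivableV h0 dh)); exact: deriveV h0 dh.
apply: is_derive_eq; rewrite /GRing.scale /=; field; exact: h0.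
Qed.

Lemma is_derive_mean_curvature_warped (r : R) : oint a b r ->
  is_derive r 1 (fun t => mean_curvature (warped h Ghat) c t p)
    (k%:R * (h^`(2)%classic r / h r - (h^`()%classic r / h r) ^+ 2)).
Proof.
move=> rr; have D := is_derive_log _ rr.
apply: (@near_eq_is_derive _ _ _ (fun t => k%:R * (h^`()%classic t / h t))).
  near=> t; rewrite mean_curvature_warped//; near: t; exact: near_oint.
Unshelve. all: by end_near. Qed.

Lemma ricci_rr_warped (r : R) : oint a b r ->
  ricci_rr a b (warped h Ghat) c r p = - k%:R * (h^`(2)%classic r / h r).
Proof.
move=> rr; have D := is_derive_mean_curvature_warped _ rr.
rewrite (ricci_rr_riccati hA)//.
- rewrite derive_val weingarten_warped_oint// mul_scalar_mx scale_scalar_mx.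
  rewrite mxtrace_scalar -mulr_natl; ring.
- move=> t rt; rewrite unitmxZ; first exact: riemannian_unitmx.
  by rewrite unitfE expf_neq0// gt_eqF// hpos.
- move=> i; have D' := is_derive_log _ rr.
  apply: (@near_eq_derivable _ _ _ (fun t => h^`()%classic t / h t)).
    near=> t; rewrite weingarten_warped_oint ?mxE ?eqxx//.
    by near: t; exact: near_oint.
  exact: ex_derive.
Unshelve. all: by end_near. Qed.

End WarpedBackground.

(** * Evolution of the radial mass *)

Lemma radial_mass_evolution (R : realType) (k : nat) (N : topologicalType)
    (A : atlas R k N) (a b : \bar R) (G : R -> tensor2 A) (h : R -> R)
    (Ghat : tensor2 A) (c : chart A) (r : R) (p : N) :
  (0 < k)%N -> is_smooth_manifold A ->
  (forall t : R, oint a b t -> is_riemannian (G t)) ->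
  is_riemannian (dr2_plus a b G) ->
  smooth_oint a b h -> (forall t : R, oint a b t -> 0 < h t) ->
  is_riemannian Ghat -> oint a b r -> chart_dom c p ->
  is_derive r 1 (fun t => radial_mass h Ghat G c t p)
    (h r ^+ 2 * (ricci_rr a b G c r p - ricci_rr a b (warped h Ghat) c r p)
     + k%:R^-1 * (radial_mass h Ghat G c r p ^+ 2 / h r ^+ 2)
     + h r ^+ 2 * endo_normsq (G r c p) (weingarten_tracefree G c r p)).
Proof.
move=> k0 hA hG hg hs hpos hGhat rr dp.
have k1 : (k%:R : R) != 0 by rewrite pnatr_eq0 -lt0n.
have h0 : h r != 0 by rewrite gt_eqF// hpos.
have uG t : oint a b t -> G t c p \in unitmx.
  by move=> rt; apply: riemannian_unitmx => //; exact: hG.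
have Gsym t : oint a b t -> (G t c p)^T = G t c p.
  by move=> rt; exact: (riem_sym (hG t rt) dp).
have C2 i j := radially_C2 hA _ _ c G p r i j hg rr dp.
have dW : forall i j, derivable (fun t => weingarten G c t p i j) r 1.
  apply: derivable_weingarten => [|i j|i j].
  - near=> t; apply: uG; near: t; exact: near_oint.
  - by have [] := C2 i j.
  - by have [] := C2 i j.
have Dsym : (dr_tensor G c r p)^T = dr_tensor G c r p.
  apply/matrixP => i j; rewrite !mxE !derive1E; apply: near_eq_derive.
  near=> t; rewrite -[in RHS]Gsym ?mxE//; near: t; exact: near_oint.
have dh : is_derive r 1 h (h^`()%classic r).
  have [dh _] := smooth_oint_derivable2 _ _ _ _ hs rr.
  exact: (derivable_is_derive1 _ _ dh).
have dH0 := is_derive_mean_curvature_warped a b h _ hs hpos hGhat _ _ dp _ rr.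
have dH : derivable (fun t => mean_curvature G c t p) r 1.
  exact: derivable_bigsum.
have {}dH := derivableP dH.
have -> : endo_normsq (G r c p) (weingarten_tracefree G c r p) =
    - 'D_1 (fun t => mean_curvature G c t p) r - ricci_rr a b G c r p
    - mean_curvature G c r p ^+ 2 / k%:R.
  rewrite normsq_weingarten_tracefree ?uG ?Gsym// (ricci_rr_riccati hA)//.
  by ring.
rewrite (ricci_rr_warped hA)// /radial_mass.
apply: is_derive_eq.
rewrite /GRing.scale /= (mean_curvature_warped a b)//.
by field; rewrite k1 h0.
Unshelve. all: by end_near. Qed.

Theorem mainTheorem4 (R : realType) (n : nat) (hn : (2 <= n)%N)
  (N : topologicalType) (A : atlas R n.-1 N)
  (hA : is_smooth_manifold A) (hN : compact [set: N])
  (a b : \bar R) (hab : (a < b)%E)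
  (G : R -> tensor2 A)
  (hG : forall r : R, oint a b r -> is_riemannian (G r))
  (hg : is_riemannian (dr2_plus a b G))
  (h : R -> R) (hsmooth : smooth_oint a b h)
  (hpos : forall r : R, oint a b r -> 0 < h r)
  (Ghat : tensor2 A) (hGhat : is_riemannian Ghat) :
  forall (c : chart A) (r : R) (p : N), oint a b r -> chart_dom c p ->
    let m := radial_mass h Ghat G c in
    let Rrr := ricci_rr a b G c r p in
    let Rrr0 := ricci_rr a b (warped h Ghat) c r p in
    let s := weingarten_tracefree G c r p in
    [/\ is_derive r 1 (fun t : R => m t p)
          (h r ^+ 2 * (Rrr - Rrr0)
           + (n%:R - 1)^-1 * (m r p ^+ 2 / h r ^+ 2)
           + h r ^+ 2 * endo_normsq (G r c p) s),
        Rrr0 = - (n%:R - 1) * (h^`(2)%classic r / h r)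
      & mean_curvature (warped h Ghat) c r p = (n%:R - 1) * (h^`()%classic r / h r)].
Proof.
case: n hn A hA G hG hg Ghat hGhat => [//|k] k0 A hA G hG hg Ghat hGhat c r p rr dp.
have -> : k.+1%:R - 1 = k%:R :> R by rewrite -natr1 addrK.
move=> m Rrr Rrr0 s; split.
- exact: (radial_mass_evolution _ _ _ _ _ _ _ _ _ _ _ _ k0 hA hG hg hsmooth hpos).
- exact: (ricci_rr_warped hA _ _ _ _ hsmooth hpos hGhat).
- exact: (mean_curvature_warped _ _ _ _ hsmooth hpos hGhat).
Qed.
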